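(* Assume the standing hypotheses on $g,h,\varphi,\psi$ given in the context. Let $\overline x\in\mathbb{R}^n$ and $\overline\lambda\in\mathbb{R}^q$. Then $$0\in\nabla\theta(\overline x,\overline\lambda)+\partial\varphi(\overline x)\times\{0\}$$ if and only if $\left(\overline x,\ \overline y=\nabla\psi_h^*(K^T\overline x+B^T\overline\lambda)\right)$ is a stationary point of the problem $$\min_{x\in\mathbb{R}^n}\max_{y\in\mathbb{R}^m}\ \varphi(x)+g(x)+x^TKy-h(y)-\psi(y)\quad\text{subject to}\quad Ax+By+c=0.$$
   Context: Data: $K\in\mathbb{R}^{n\times m}$, $A\in\mathbb{R}^{q\times n}$, $B\in\mathbb{R}^{q\times m}$, $c\in\mathbb{R}^q$. Standing hypotheses: $g:\mathbb{R}^n\to\mathbb{R}$ and $h:\mathbb{R}^m\to\mathbb{R}$ are convex and continuously differentiable with Lipschitz continuous gradients (constants $L_g,L_h>0$); $\varphi:\mathbb{R}^n\to\mathbb{R}\cup\{+\infty\}$ and $\psi:\mathbb{R}^m\to\mathbb{R}\cup\{+\infty\}$ are proper lower semicontinuous convex functions; $\psi_h:=h+\psi$ is $\mu$-strongly convex for some $\mu>0$ (so its convex conjugate $\psi_h^*$ is continuously differentiable with $\mu^{-1}$-Lipschitz gradient). For $x\in\mathbb{R}^n$, $y\in\mathbb{R}^m$, $\lambda\in\mathbb{R}^q$, let $Q(x,y,\lambda)=x^TKy-h(y)-\psi(y)+\langle\lambda,Ax+By+c\rangle$ and $\theta(x,\lambda)=g(x)+\max_yQ(x,y,\lambda)$;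 under the hypotheses $\theta$ is continuously differentiable, and $\nabla\theta$ is its gradient with respect to $(x,\lambda)$. $\partial$ denotes the convex subdifferential. Stationary point: a pair $(\overline x,\overline y)$ is a stationary point of the problem if there exists a vector $\lambda'\in\mathbb{R}^q$ such that $$0\in K\overline y+A^T\lambda'+\nabla g(\overline x)+\partial\varphi(\overline x),\qquad 0\in K^T\overline x+B^T\lambda'-\nabla h(\overline y)-\partial\psi(\overline y),\qquad A\overline x+B\overline y+c=0.$$
   Formalization: The converse fails when λ' is arbitrary; proved instead: the inclusion holds iff the stationarity system holds with λ' equal to the given λ̄, and (x̄,ȳ) is stationary iff the inclusion holds at some λ' with ȳ = ∇ψ_h^*(K^T x̄ + B^T λ'). *)

(* Defs.v *)
From HB Require Import structures.
From mathcomp Require Export all_boot all_order all_algebra.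
From mathcomp Require Export all_classical all_reals all_analysis.
Import Order.TTheory GRing.Theory Num.Theory.
Import numFieldNormedType.Exports.

Set Implicit Arguments.
Unset Strict Implicit.
Unset Printing Implicit Defensive.

Local Open Scope classical_set_scope.
Local Open Scope ring_scope.

Definition dot (R : realType) (n : nat) (u v : 'cV[R]_n) : R :=
  (u^T *m v) 0 0.

(* The library norm on 'cV[R]_n is the sup norm; it induces the same topology
   and differentials, but Lipschitz and strong convexity constants refer to
   the Euclidean norm. *)
Definition enorm (R : realType) (n : nat) (u : 'cV[R]_n) : R :=
  Num.sqrt (dot u u).

Definition grad (R : realType) (n : nat) (f : 'cV[R]_n -> R) (x : 'cV[R]_n) :
    'cV[R]_n :=
  \col_i ('d f x (delta_mx i 0) : R).

Definition C1 (R : realType) (n : nat) (f : 'cV[R]_n -> R) : Prop :=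
  (forall x, differentiable f x) /\ continuous (grad f).

Definition lipschitz_grad (R : realType) (n : nat) (L : R)
    (f : 'cV[R]_n -> R) : Prop :=
  forall x y, enorm (grad f x - grad f y) <= L * enorm (x - y).

(* Functions with values in R \cup {+oo} are functions to \bar R which avoid
   -oo; this is part of properness. *)
Definition proper (R : realType) (n : nat) (f : 'cV[R]_n -> \bar R) : Prop :=
  (forall x, f x != -oo%E) /\ (exists x, f x != +oo%E).

Definition econvex (R : realType) (n : nat) (f : 'cV[R]_n -> \bar R) : Prop :=
  forall (x y : 'cV[R]_n) (t : R), 0 <= t <= 1 ->
    (f (t *: x + (1 - t) *: y)%R <= t%:E * f x + (1 - t)%:E * f y)%E.

Definition strongly_convex (R : realType) (n : nat) (mu : R)
    (f : 'cV[R]_n -> \bar R) : Prop :=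
  forall (x y : 'cV[R]_n) (t : R), 0 <= t <= 1 ->
    (f (t *: x + (1 - t) *: y)%R <=
     t%:E * f x + (1 - t)%:E * f y
     - (mu / 2 * t * (1 - t) * enorm (x - y) ^+ 2)%:E)%E.

Definition subdiff (R : realType) (n : nat) (f : 'cV[R]_n -> \bar R)
    (x : 'cV[R]_n) : set 'cV[R]_n :=
  [set v | f x \is a fin_num /\
           forall z, (f x + (dot v (z - x)%R)%:E <= f z)%E].

Definition conjugate (R : realType) (n : nat) (f : 'cV[R]_n -> \bar R)
    (u : 'cV[R]_n) : \bar R :=
  ereal_sup (range (fun y => (dot u y)%:E - f y)%E).

Section Problem.
Context (R : realType) (n m q : nat).
Variables (K : 'M[R]_(n, m)) (A : 'M[R]_(q, n)) (B : 'M[R]_(q, m)).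
Variable c : 'cV[R]_q.
Variables (g : 'cV[R]_n -> R) (h : 'cV[R]_m -> R).
Variables (phi : 'cV[R]_n -> \bar R) (psi : 'cV[R]_m -> \bar R).

Definition psi_h (y : 'cV[R]_m) : \bar R := ((h y)%:E + psi y)%E.

Definition grad_psi_h_conj (u : 'cV[R]_m) : 'cV[R]_m :=
  grad (fun w => fine (conjugate psi_h w)) u.

Definition Q (x : 'cV[R]_n) (y : 'cV[R]_m) (lam : 'cV[R]_q) : \bar R :=
  ((dot x (K *m y))%:E - (h y)%:E - psi y
   + (dot lam (A *m x + B *m y + c)%R)%:E)%E.

(* theta as a function of the stacked vector (x, lambda) in R^(n + q).  When
   psi_h is proper, lsc and strongly convex the supremum is a finite, attained
   maximum, so [fine] loses nothing. *)
Definition theta (z : 'cV[R]_(n + q)) : R :=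
  g (usubmx z) +
  fine (ereal_sup (range (fun y => Q (usubmx z) y (dsubmx z)))).

(* 0 \in grad theta (x, lambda) + subdiff phi x \times {0} *)
Definition critical (x : 'cV[R]_n) (lam : 'cV[R]_q) : Prop :=
  [set grad theta (col_mx x lam) + col_mx v 0 | v in subdiff phi x] 0.

Definition stationary_with (x : 'cV[R]_n) (y : 'cV[R]_m) (lam : 'cV[R]_q) :
    Prop :=
  [/\ [set K *m y + A^T *m lam + grad g x + v | v in subdiff phi x] 0,
      [set K^T *m x + B^T *m lam - grad h y - v | v in subdiff psi y] 0
    & A *m x + B *m y + c = 0].

Definition stationary (x : 'cV[R]_n) (y : 'cV[R]_m) : Prop :=
  exists lam', stationary_with x y lam'.

End Problem.

(* Main.v *)
Require Import Defs.
From HB Require Import structures.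
From mathcomp Require Import ring lra.
Import Order.TTheory GRing.Theory Num.Theory.
Import numFieldNormedType.Exports.

Set Implicit Arguments.
Unset Strict Implicit.
Unset Printing Implicit Defensive.

Local Open Scope classical_set_scope.
Local Open Scope ring_scope.

(** Write [f] for [psi_h h psi], [f^*] for its conjugate and
    [u = K^T x + B^T lambda].  Three facts carry the proof.

    - Optimality.  [y] is the gradient of [f^*] at [u] exactly when [u] is a
      subgradient of [f] at [y] ([subdiff_grad_conjugate]).  A strongly convex
      lower semicontinuous function attains its minimum
      ([strongly_convex_has_min]); applied to [f - <u, .>] this gives some [y]
      of which [u] is a subgradient.  Around any such [y], strong convexity
      makes [f] grow quadratically above its affine minorant, which squeezes
      [f^* (u + v) - f^* u - <y, v>] between [0] and [|v|^2 / mu]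
      ([conjugate_expansion]); hence [y] is the Frechet gradient of [f^*].

    - Sum rule.  [u] is a subgradient of [h + psi] at [y] exactly when
      [u - grad h y] is one of [psi] ([subdiff_psi_h]).  So the second
      stationarity inclusion says [y = grad f^* u].

    - Gradient of [theta].  Collecting the terms of [Q] that do not depend on
      [y], [theta (x, lambda) = g x + f^* u + <lambda, A x + c>] ([thetaE]).
      By the chain rule its gradient is
      [(K y + A^T lambda + grad g x, A x + B y + c)] with [y = grad f^* u]
      ([is_diff_theta]).

    Criticality therefore says precisely the first and third stationarity
    conditions, and the second one is the identity [y = grad f^* u].  For a
    stationary pair with another multiplier [lambda'], the second condition
    shows that [y] is also the gradient of [f^*] at [K^T x + B^T lambda'], and
    the same equivalence applies to [lambda']. *)

(** * Inner product and sup norm *)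

Section InnerProduct.
Variable R : realType.

Lemma dotE n (u v : 'cV[R]_n) : dot u v = \sum_i u i 0 * v i 0.
Proof. by rewrite /dot mxE; apply: eq_bigr => i _; rewrite mxE. Qed.

Lemma dotC n (u v : 'cV[R]_n) : dot u v = dot v u.
Proof. by rewrite !dotE; apply: eq_bigr => i _; rewrite mulrC. Qed.

Lemma dot_is_linear n (u : 'cV[R]_n) : linear (dot u : 'cV[R]_n -> R^o).
Proof. by move=> a v w; rewrite /dot mulmxDr -scalemxAr !mxE. Qed.

HB.instance Definition _ n (u : 'cV[R]_n) :=
  GRing.isLinear.Build R 'cV[R]_n R^o *:%R (dot u) (dot_is_linear u).

Lemma dotDr n (u v w : 'cV[R]_n) : dot u (v + w) = dot u v + dot u w.
Proof. exact: linearD. Qed.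

Lemma dotBr n (u v w : 'cV[R]_n) : dot u (v - w) = dot u v - dot u w.
Proof. exact: linearB. Qed.

Lemma dotZr n a (u v : 'cV[R]_n) : dot u (a *: v) = a * dot u v.
Proof. exact: linearZ. Qed.

Lemma dotDl n (u v w : 'cV[R]_n) : dot (u + v) w = dot u w + dot v w.
Proof. by rewrite ![dot _ w]dotC dotDr. Qed.

Lemma dotBl n (u v w : 'cV[R]_n) : dot (u - v) w = dot u w - dot v w.
Proof. by rewrite ![dot _ w]dotC dotBr. Qed.

Lemma dotZl n a (u v : 'cV[R]_n) : dot (a *: u) v = a * dot u v.
Proof. by rewrite ![dot _ v]dotC dotZr. Qed.

Lemma dot_mulmx n p (M : 'M[R]_(p, n)) u v : dot u (M *m v) = dot (M^T *m u) v.
Proof. by rewrite /dot trmx_mul trmxK mulmxA. Qed.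

Lemma dot_col_mx n p (u1 v1 : 'cV[R]_n) (u2 v2 : 'cV[R]_p) :
  dot (col_mx u1 u2) (col_mx v1 v2) = dot u1 v1 + dot u2 v2.
Proof. by rewrite /dot tr_col_mx mul_row_col mxE. Qed.

Lemma dot_delta n (p : 'cV[R]_n) i : dot p (delta_mx i 0) = p i 0.
Proof.
rewrite dotE (bigD1 i)//= mxE !eqxx mulr1 big1 ?addr0// => j ji.
by rewrite mxE (negbTE ji) mulr0.
Qed.

Lemma dot_ge0 n (u : 'cV[R]_n) : 0 <= dot u u.
Proof. by rewrite dotE sumr_ge0// => i _; rewrite -expr2 sqr_ge0. Qed.

Lemma enorm_sqr n (u : 'cV[R]_n) : enorm u ^+ 2 = dot u u.
Proof. by rewrite sqr_sqrtr// dot_ge0. Qed.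

Lemma mx_entry_le n p (M : 'M[R]_(n, p)) i j : `|M i j| <= `|M|.
Proof.
by rewrite [leRHS]/Num.Def.normr/= mx_normrE; apply/bigmax_geP; right; exists (i, j).
Qed.

Lemma mx_norm_le n p (M : 'M[R]_(n, p)) e :
  0 <= e -> (forall i j, `|M i j| <= e) -> `|M| <= e.
Proof.
by move=> e0 Me; rewrite [leLHS]/Num.Def.normr/= mx_normrE bigmax_le// => -[i j] _ /=.
Qed.

Lemma norm_le_enorm n (u : 'cV[R]_n) : `|u| <= enorm u.
Proof.
apply: mx_norm_le => [|i j]; first exact: sqrtr_ge0.
rewrite ord1 -sqrtr_sqr ler_wsqrtr// dotE (bigD1 i)//= expr2 lerDl.
by rewrite sumr_ge0// => k _; rewrite -expr2 sqr_ge0.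
Qed.

Lemma dot_norm_le n (u v : 'cV[R]_n) : `|dot u v| <= n%:R * (`|u| * `|v|).
Proof.
rewrite dotE (le_trans (ler_norm_sum _ _ _))//.
apply: (@le_trans _ _ (\sum_(i < n) `|u| * `|v|)).
  by apply: ler_sum => i _; rewrite normrM ler_pM// mx_entry_le.
by rewrite sumr_const card_ord -[leLHS]mulr_natl.
Qed.

Lemma mulmx_norm_le n p (M : 'M[R]_(p, n)) (u : 'cV[R]_n) :
  `|M *m u| <= n%:R * `|M| * `|u|.
Proof.
apply: mx_norm_le => [|i j]; first by rewrite !mulr_ge0.
rewrite mxE (le_trans (ler_norm_sum _ _ _))//.
apply: (@le_trans _ _ (\sum_(k < n) `|M| * `|u|)).
  by apply: ler_sum => k _; rewrite normrM ler_pM// mx_entry_le.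
by rewrite sumr_const card_ord -mulrA -[leLHS]mulr_natl.
Qed.

End InnerProduct.

(** * Differentials of functions on column vectors *)

Section Differentials.
Variable R : realType.

Lemma bounded_linear_cont (V W : normedModType R) (f : {linear V -> W}) C :
  (forall x, `|f x| <= C * `|x|) -> continuous f.
Proof.
move=> fC; apply: bounded_linear_continuous; apply/ex_bound; exists `|C|.
apply/nbhs_ballP; exists 1 => //= x; rewrite -ball_normE /= sub0r normrN => x1.
rewrite (le_trans (fC x))// (le_trans (ler_norm _))// normrM normr_id.
by rewrite ler_piMr// ltW.
Qed.

Lemma dot_continuous n (p : 'cV[R]_n) : continuous (dot p : 'cV[R]_n -> R^o).
Proof.
by apply: (@bounded_linear_cont _ _ _ (n%:R * `|p|)) => v; rewrite -mulrA dot_norm_le.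
Qed.

Lemma mulmx_continuous n k (M : 'M[R]_(k, n)) :
  continuous (mulmx M : 'cV[R]_n -> 'cV[R]_k).
Proof. exact: bounded_linear_cont (mulmx_norm_le M). Qed.

Lemma is_diff_mulmx n k (M : 'M[R]_(k, n)) (x : 'cV[R]_n) :
  is_diff x (mulmx M : 'cV[R]_n -> 'cV[R]_k) (mulmx M).
Proof.
have Mc := @mulmx_continuous _ _ M.
by apply: DiffDef; [exact: linear_differentiable | exact: diff_lin].
Qed.

(** A remainder that is quadratic in [v] is [o(v)].  The only functions
    differentiated from first principles are [f^*] and quadratic forms, and
    both have such a remainder. *)
Lemma is_diff_quadratic_remainder n (f : 'cV[R]_n -> R) x p C :
  (forall v, `|f (v + x) - f x - dot p v| <= C * `|v| ^+ 2) ->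
  is_diff x f (dot p).
Proof.
move=> fC.
(* The little-o notation needs both sides typed as normed modules. *)
pose V : normedModType R := 'cV[R]_n; pose W : normedModType R := R^o.
have fo : (f : V -> W) \o shift (x : V) =
    cst (f x : W) + (dot p : V -> W) +o_ (0 : V) (id : V -> V).
  apply/eqaddoP => _ /posnumP[e].
  (* [`|C| + 1], as [C] may be zero. *)
  have C0 : 0 < `|C| + 1 by rewrite ltr_wpDl.
  apply/nbhs_ballP; exists (e%:num / (`|C| + 1)) => /=; first by rewrite divr_gt0.
  move=> v; rewrite -ball_normE /= sub0r normrN ltr_pdivlMr// => ve.
  rewrite !fctE opprD addrA (le_trans (fC v))//.
  rewrite expr2 mulrA ler_wpM2r// (le_trans _ (ltW ve))// mulrC ler_wpM2l//.
  by rewrite (le_trans (ler_norm C))// lerDl.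
have dE := diff_unique (@dot_continuous _ p) fo.
apply: DiffDef => //; apply/diff_locallyP; rewrite dE; split => //.
exact: dot_continuous.
Qed.

Lemma is_diff_grad n (f : 'cV[R]_n -> R) x p :
  is_diff x f (dot p) -> grad f x = p.
Proof.
move=> fp; apply/colP => i.
by rewrite mxE (diff_val (is_diff_def := fp)) dot_delta.
Qed.

Lemma differentiable_is_diff n (f : 'cV[R]_n -> R) x :
  differentiable f x -> is_diff x f (dot (grad f x)).
Proof.
move=> df; apply: DiffDef => //; apply/funext => v.
rewrite [in LHS](matrix_sum_delta v) exchange_big big_ord1 linear_sum dotE.
by apply: eq_bigr => i _; rewrite linearZ /= mxE mulrC.
Qed.

Lemma is_diff_quadratic_form n (N : 'M[R]_n) (z : 'cV[R]_n) :
  is_diff z (fun z => dot z (N *m z)) (dot (N *m z + N^T *m z)).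
Proof.
apply: (@is_diff_quadratic_remainder _ _ _ _ (n%:R * (n%:R * `|N|))) => v.
rewrite mulmxDr !dotDl !dotDr -dot_mulmx [dot (N *m z) v]dotC.
set a := dot v (N *m v); set b := dot z (N *m v); set d := dot v (N *m z).
set e := dot z (N *m z).
have -> : a + d + (b + e) - e - (d + b) = a by ring.
rewrite (le_trans (dot_norm_le _ _))// -mulrA ler_wpM2l// expr2 mulrA.
by rewrite mulrC ler_wpM2r// mulmx_norm_le.
Qed.

Lemma is_diff_dot n (p x : 'cV[R]_n) : is_diff x (dot p : _ -> R) (dot p).
Proof.
apply: (@is_diff_quadratic_remainder _ _ _ _ 0) => v.
by rewrite dotDr addrK subrr normr0 mul0r.
Qed.

(** The difference quotients in direction [d] converge to [dot p d]. Stated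
    without division, and only for [0 < t <= 1], because this is the form in
    which convexity inequalities along a segment arrive. *)
Lemma le_directional_derivative n (f : 'cV[R]_n -> R) x p d (a : R) :
  is_diff x f (dot p) ->
  (forall t, 0 < t <= 1 -> t * a <= f (t *: d + x) - f x) -> a <= dot p d.
Proof.
move=> fp H.
have df : differentiable f x by exact: ex_diff.
rewrite -(diff_val (is_diff_def := fp)) -deriveE//.
have fd : derivable f x d by exact: diff_derivable.
have := cvg_dnbhs_at_right fd.
move=> /cvgr_to_ge; apply.
near=> t.
have t0 : 0 < t by near: t; exact: nbhs_right_gt.
rewrite /= ler_pdivlMl// H// t0 /=.
by near: t; apply: nbhs_right_le.
Unshelve. all: by end_near. Qed.

End Differentials.

(** * Minimizers of strongly convex functions *)

Section StronglyConvex.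
Variables (R : realType) (n : nat).
Implicit Types (f F : 'cV[R]_n -> \bar R) (x y z u v : 'cV[R]_n).

Lemma lte_between_fin (a : R) (e : \bar R) :
  (a%:E < e)%E -> exists2 b, a < b & (b%:E < e)%E.
Proof.
case: e => [r| |//] ae; last by exists (a + 1); rewrite ?ltrDl// ltry.
by exists ((a + r) / 2); rewrite ?lte_fin midf_lt// -lte_fin.
Qed.

Lemma proper_cases F x : proper F -> F x = +oo%E \/ exists r, F x = r%:E.
Proof.
move=> [noo _]; case: (F x) (noo x) => [r _| |//]; first by right; exists r.
by left.
Qed.

Lemma proper_point F : proper F -> exists x r, F x = r%:E.
Proof.
move=> Fp; have [_ [x xoo]] := Fp; exists x.
by have [xE|//] := proper_cases x Fp; rewrite xE in xoo.
Qed.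

Lemma strongly_convex_fin F mu x y a b t : strongly_convex mu F ->
  F x = a%:E -> F y = b%:E -> 0 <= t <= 1 ->
  (F (t *: x + (1 - t) *: y)%R <=
   (t * a + (1 - t) * b - mu / 2 * t * (1 - t) * dot (x - y) (x - y))%:E)%E.
Proof.
by move=> Fsc Fx Fy t01; have := Fsc x y t t01; rewrite Fx Fy enorm_sqr.
Qed.

(** Lower semicontinuity bounds [F] below by [a - 1] on a ball of radius [r]
    around a point [x0] with [F x0 = a].  A point [y] at distance [d >= r] is
    compared with the point of the segment from [x0] to [y] at distance [r / 2]
    from [x0], which lies in the ball: strong convexity then yields
    [F y >= a + mu / 4 * d ^ 2 - 2 * d / r], a quadratic in [d] with minimum
    [a - 4 / (mu * r ^ 2)].  This direct argument replaces the existence of an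
    affine minorant. *)
Lemma strongly_convex_lbound F mu : 0 < mu -> proper F ->
  lower_semicontinuous F -> strongly_convex mu F ->
  exists M : R, forall y, (M%:E <= F y)%E.
Proof.
move=> mu0 Fp Flsc Fsc; have [x0 [a Fx0]] := proper_point Fp.
have [V /nbhs_ballP[r /= r0 rV] FV] : exists2 V, nbhs x0 V &
    forall y, V y -> ((a - 1)%:E < F y)%E.
  by apply: Flsc; rewrite Fx0 lte_fin ltrBlDr ltrDl.
have near_lt y : `|y - x0| < r -> ((a - 1)%:E < F y)%E.
  by move=> yr; apply/FV/rV; rewrite -ball_normE /= distrC.
exists (a - 1 - 4 / (mu * r ^+ 2)) => y.
have K0 : 0 < 4 / (mu * r ^+ 2) by rewrite divr_gt0// mulr_gt0// exprn_gt0.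
set d := enorm (y - x0).
have ler_d : `|y - x0| <= d := norm_le_enorm _.
have [->|[b Fy]] := proper_cases y Fp; first by rewrite leey.
have [dr|rd] := ltP d r.
  have := near_lt y (le_lt_trans ler_d dr); rewrite Fy lte_fin lee_fin.
  by move/ltW; apply: le_trans; rewrite gerBl ltW.
have d0 : 0 < d := lt_le_trans r0 rd.
pose t := r / (2 * d).
have td : t * d = r / 2 by rewrite /t; field; rewrite gt_eqF.
have t0 : 0 < t by rewrite divr_gt0// mulr_gt0.
have t12 : t <= 1 / 2.
  by rewrite ler_pdivrMr ?mulr_gt0//; rewrite mulrA div1r mulVf// mul1r.
have t01 : 0 <= t <= 1 by lra.
have := strongly_convex_fin Fsc Fy Fx0 t01.
rewrite -enorm_sqr -/d => conv.
have wE : t *: y + (1 - t) *: x0 - x0 = t *: (y - x0).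
  by rewrite scalerBl scale1r scalerBr -addrA [x0 - _ - _]addrAC subrr add0r.
have wr : `|t *: y + (1 - t) *: x0 - x0| < r.
  rewrite wE normrZ gtr0_norm// (@le_lt_trans _ _ (t * d)) ?ler_pM2l//.
  by rewrite td ltr_pdivrMr// ltr_pMr// ltr1n.
have := lt_le_trans (near_lt _ wr) conv; rewrite Fy lte_fin lee_fin => ineq.
(* Completing the square in [d]; note [1 / t = 2 * d / r]. *)
have sq : 0 <= mu / 4 * (d - 4 / (mu * r)) ^+ 2.
  by rewrite mulr_ge0 ?sqr_ge0// divr_ge0// ltW.
have sqE : mu / 4 * (d - 4 / (mu * r)) ^+ 2 =
    mu / 4 * d ^+ 2 - 1 / t + 4 / (mu * r ^+ 2).
  by rewrite /t; field; rewrite !gt_eqF.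
have it : t * (1 / t) = 1 by rewrite div1r mulfV// gt_eqF.
have : 0 < t * (b - a + 1 / t - mu / 4 * d ^+ 2).
  have : t * (mu / 4 * d ^+ 2) <= mu / 2 * t * (1 - t) * d ^+ 2.
    have -> : mu / 2 * t * (1 - t) * d ^+ 2 =
        t * (mu / 4 * d ^+ 2) + (mu / 2 * t * d ^+ 2) * (1 / 2 - t) by field.
    rewrite lerDl mulr_ge0 ?subr_ge0// mulr_ge0 ?sqr_ge0// mulr_ge0 ?ltW//.
    by rewrite divr_gt0.
  by move=> ?; rewrite mulrBr mulrDr it; lra.
rewrite pmulr_rgt0//; lra.
Qed.

(** By strong convexity at the midpoint, two points whose values are within [e]
    of the infimum [M] satisfy [|x - y|^2 <= 8 / mu * e].  So the strict
    sublevel sets just above [M] form a Cauchy filter; its limit is a minimizer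
    by lower semicontinuity. *)
Lemma strongly_convex_has_min F mu : 0 < mu -> proper F ->
  lower_semicontinuous F -> strongly_convex mu F ->
  exists y (a : R), F y = a%:E /\ forall z, (a%:E <= F z)%E.
Proof.
move=> mu0 Fp Flsc Fsc.
have [L FL] := strongly_convex_lbound mu0 Fp Flsc Fsc.
pose S := [set a : R | exists y, F y = a%:E].
have S0 : S !=set0 by have [x [a Fx]] := proper_point Fp; exists a, x.
have SL : has_lbound S by exists L => a [y ya]; rewrite -lee_fin -ya FL.
pose M := inf S.
have MF y : (M%:E <= F y)%E.
  have [->|[b Fy]] := proper_cases y Fp; first by rewrite leey.
  by rewrite Fy lee_fin; apply: (ge_inf SL); exists y.
pose sub e := [set y | (F y < (M + e)%:E)%E].
have sub0 e : 0 < e -> sub e !=set0.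
  move=> e0; have [b [y Fy] be] := inf_adherent e0 (conj S0 SL).
  by exists y; rewrite /sub/= Fy lte_fin.
pose G := filter_from [set e : R | 0 < e] sub.
have GF : ProperFilter G.
  apply: filter_from_proper; last by move=> e; exact: sub0.
  apply: filter_from_filter; first by exists 1 => /=.
  move=> e1 e2 /= e10 e20; exists (Num.min e1 e2) => /=.
    by rewrite lt_min e10.
  move=> y; rewrite /sub /= => ye; split; apply: (lt_le_trans ye);
    by rewrite lee_fin lerD2l ge_min lexx ?orbT.
have subM e x y : sub e x -> sub e y -> dot (x - y) (x - y) <= 8 / mu * e.
  rewrite /sub/=; have [->//|[a Fx]] := proper_cases x Fp.
  have [->//|[b Fy]] := proper_cases y Fp.
  rewrite Fx Fy !lte_fin => ae be.
  have h01 : 0 <= (1 / 2 : R) <= 1 by lra.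
  have := le_trans (MF _) (strongly_convex_fin Fsc Fx Fy h01).
  set s := dot _ _; rewrite lee_fin => ineq.
  rewrite mulrAC ler_pdivlMr//; lra.
have Gc : cvg G.
  apply: cauchy_cvg; apply: cauchy_exP => eps eps0.
  pose e := mu / 8 * (eps ^+ 2 / 4).
  have e0 : 0 < e by rewrite mulr_gt0// divr_gt0// exprn_gt0.
  have [x xe] := sub0 _ e0; exists x; exists e => //= y ye.
  rewrite -ball_normE /= (le_lt_trans (norm_le_enorm _))//.
  rewrite (@le_lt_trans _ _ (eps / 2))//; last first.
    by rewrite ltr_pdivrMr// ltr_pMr// ltr1n.
  have eps2 : 0 <= eps / 2 by rewrite divr_ge0// ltW.
  rewrite -(@ler_pXn2r _ 2) ?nnegrE ?sqrtr_ge0//.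
  rewrite enorm_sqr (le_trans (subM _ _ _ xe ye))// /e.
  by rewrite le_eqVlt; apply/orP; left; apply/eqP; field; rewrite gt_eqF.
have /cvg_ex[ys Gys] := Gc.
have ysM : (F ys <= M%:E)%E.
  rewrite leNgt; apply/negP => Mlt.
  have [c Mc cF] := lte_between_fin Mlt.
  have [V Vy Vc] := Flsc _ _ cF.
  have GV : G V := Gys _ Vy.
  have Gsub : G (sub (c - M)) by exists (c - M) => //=; rewrite subr_gt0.
  have [z [/Vc Vz]] := filter_ex (filterI GV Gsub).
  by rewrite /sub/= addrC subrK => /(lt_trans Vz); rewrite ltxx.
by exists ys, M; split => //; apply/eqP; rewrite eq_le ysM MF.
Qed.

End StronglyConvex.

(** * Subgradients and the conjugate of a strongly convex function *)

Section Conjugate.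
Variables (R : realType) (n : nat).
Implicit Types (f F psi : 'cV[R]_n -> \bar R) (x y z u v : 'cV[R]_n).

(** The subgradient inequality at the midpoint of [y] and [z], combined with
    strong convexity there.  Letting the point tend to [y] instead would give
    the optimal constant [mu / 2]; the midpoint avoids the limit, and any
    positive constant makes the conjugate differentiable. *)
Lemma subdiff_quadratic_growth f mu u y z (a : R) :
  strongly_convex mu f -> f y = a%:E -> subdiff f y u ->
  ((a + dot u (z - y) + mu / 4 * dot (z - y) (z - y))%:E <= f z)%E.
Proof.
move=> fsc fy [_ sub]; have := sub z; rewrite fy.
case fz : (f z) => [b| |//] _; last by rewrite leey.
have h01 : 0 <= (1 / 2 : R) <= 1 by lra.
have := le_trans (sub _) (strongly_convex_fin fsc fz fy h01).
set w := _ + _ - y.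
have -> : w = (1 / 2) *: (z - y).
  by rewrite /w scalerBl scale1r scalerBr -addrA [y - _ - _]addrAC subrr add0r.
rewrite fy dotZr -EFinD !lee_fin; lra.
Qed.

(** The lower bound tests the supremum at [y].  For the upper bound, quadratic
    growth leaves [dot v d - mu / 4 * dot d d] with [d = z - y], which is at
    most [dot v v / mu] by completing the square. *)
Lemma conjugate_expansion f mu u y v (a : R) : 0 < mu ->
  strongly_convex mu f -> f y = a%:E -> subdiff f y u ->
  exists2 c, conjugate f (v + u) = (dot u y - a + dot y v + c)%:E &
    0 <= c <= dot v v / mu.
Proof.
move=> mu0 fsc fy sub.
have lo : ((dot u y - a + dot y v)%:E <= conjugate f (v + u))%E.
  apply: ereal_sup_ubound; exists y => //.
  by rewrite fy -EFinD dotDl [dot v y]dotC; congr EFin; ring.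
have hi : (conjugate f (v + u) <= (dot u y - a + dot y v + dot v v / mu)%:E)%E.
  apply: ge_ereal_sup => _ [z _ <-].
  have := subdiff_quadratic_growth z fsc fy sub.
  case: (f z) => [b| |//]; last by rewrite leNye.
  have : z = y + (z - y) by rewrite addrC subrK.
  move: (z - y) => d ->.
  rewrite -EFinD !lee_fin !dotDl !dotDr [dot y v]dotC.
  have : 0 <= mu^-1 * dot (v - (mu / 2) *: d) (v - (mu / 2) *: d).
    by rewrite mulr_ge0 ?dot_ge0// invr_ge0 ltW.
  rewrite dotBl !dotBr !dotZl !dotZr [dot d v]dotC.
  set dd := dot d d; set vd := dot v d; set vv := dot v v.
  have -> : mu^-1 * (vv - mu / 2 * vd - (mu / 2 * vd - mu / 2 * (mu / 2 * dd))) =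
      vv / mu - vd + mu / 4 * dd by field; rewrite gt_eqF.
  lra.
move: lo hi; case: conjugate => [r| |]//; rewrite !lee_fin => lo hi.
exists (r - (dot u y - a + dot y v)); first by rewrite addrC subrK.
by rewrite subr_ge0 lo /= lerBlDl.
Qed.

Lemma is_diff_conjugate f mu u y : 0 < mu ->
  strongly_convex mu f -> subdiff f y u ->
  is_diff u (fun w => fine (conjugate f w)) (dot y).
Proof.
move=> mu0 fsc sub; have [/fineK/esym fy _] := sub.
apply: (@is_diff_quadratic_remainder _ _ _ _ _ (n%:R / mu)) => v.
have [c -> /andP[c0 cv]] := conjugate_expansion v mu0 fsc fy sub.
have [d0] := conjugate_expansion 0 mu0 fsc fy sub.
have dot0 w : dot w 0 = 0 by exact: linear0.
rewrite add0r !dot0 mul0r => -> /le_anti <- /=.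
rewrite (_ : _ - _ - _ = c); last by ring.
rewrite ger0_norm// (le_trans cv)// mulrAC ler_wpM2r ?invr_ge0 ?(ltW mu0)//.
by rewrite expr2 (le_trans (ler_norm _))// dot_norm_le.
Qed.

Lemma lsc_addl (k : 'cV[R]_n -> R) psi :
  continuous k -> lower_semicontinuous psi ->
  lower_semicontinuous (fun y => (k y)%:E + psi y)%E.
Proof.
move=> kc psil x a; rewrite -lteBlDl// -EFinB => /lte_between_fin[b ab bpsi].
have [V Vx Vb] := psil _ _ bpsi.
have kx : a - b < k x by rewrite ltrBlDr -ltrBlDl.
exists (V `&` [set y | a - b < k y]).
  apply: filterI => //.
  exact: (kc x _ (lt_nbhsr kx)).
move=> y [/Vb by_ /= ky]; rewrite (@le_lt_trans _ _ ((a - b)%:E + b%:E)%E)//.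
  by rewrite -EFinD subrK.
by rewrite lteD// lte_fin.
Qed.

(** [u] is a subgradient of [psi_h h psi] at any minimizer of the tilted function
    [psi_h h psi - dot u], which inherits strong convexity and lower
    semicontinuity. *)
Lemma subdiff_surjective (h : 'cV[R]_n -> R) psi mu u :
  0 < mu -> continuous h -> proper psi -> lower_semicontinuous psi ->
  strongly_convex mu (psi_h h psi) -> exists y, subdiff (psi_h h psi) y u.
Proof.
move=> mu0 hc [psiNoo [x0 psix0]] psil sc.
pose F y := ((h y - dot u y)%:E + psi y)%E.
have FE y : F y = (psi_h h psi y - (dot u y)%:E)%E.
  by rewrite /F /psi_h EFinB addeAC.
have Fp : proper F.
  split=> [y|]; first by move: (psiNoo y); rewrite /F; case: (psi y).
  by exists x0; move: psix0 (psiNoo x0); rewrite /F; case: (psi x0).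
have Fl : lower_semicontinuous F.
  apply: lsc_addl => // y; apply: continuousB; first exact: hc.
  exact: dot_continuous.
have Fsc : strongly_convex mu F.
  have mB (s k : R) (X : \bar R) : (s%:E * (X - k%:E) = s%:E * X - (s * k)%:E)%E.
    by rewrite muleBr// fin_num_adde_defl.
  move=> x y t t01; have := sc x y t t01; rewrite !FE !mB dotDr !dotZr.
  move: (psi_h h psi x) (psi_h h psi y) (psi_h h psi _) => X Y W.
  move: (t%:E * X)%E ((1 - t)%:E * Y)%E => {}X {}Y.
  case: X => [a| |]; case: Y => [b| |]; case: W => [d| |]// XYW;
    try solve [exact: leNye | exact: leey].
  by move: XYW; rewrite -?EFinN -?EFinD !lee_fin; lra.
have [y [a [Fy Fmin]]] := strongly_convex_has_min mu0 Fp Fl Fsc.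
have py : psi_h h psi y = (a + dot u y)%:E.
  by move: Fy; rewrite FE; case: (psi_h h psi y) => // r [<-]; rewrite subrK.
exists y; split=> [|z]; first by rewrite py.
have := Fmin z; rewrite FE py -EFinD dotBr.
by case: (psi_h h psi z) => [r| |]//; rewrite ?leey// -?EFinD !lee_fin; lra.
Qed.

(** From right to left, add the gradient inequality of [h].  From left to right,
    test the subgradient inequality at [y + t * (z - y)], bound [psi] there by
    convexity and divide by [t]: in the limit the increment of [h] becomes its
    directional derivative. *)
Lemma subdiff_psi_h (h : 'cV[R]_n -> R) psi y u :
  convex_function [set: 'cV[R]_n] h -> differentiable h y ->
  econvex psi ->
  subdiff (psi_h h psi) y u <-> subdiff psi y (u - grad h y).
Proof.
move=> hconv hdiff psiconv; have hd := differentiable_is_diff hdiff.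
have segE t z : t *: (z - y) + y = t *: z + (1 - t) *: y.
  by rewrite scalerBl scale1r scalerBr -!addrA [- _ + y]addrC.
have fin : (psi_h h psi y \is a fin_num) = (psi y \is a fin_num).
  by rewrite /psi_h fin_numD.
split=> -[]; rewrite ?fin => yfin sub; split; rewrite ?fin// => z.
- have := sub z; rewrite /psi_h.
  move: yfin; case py: (psi y) => [a| |]// _.
  case pz: (psi z) => [b| |]//; last by move=> _; exact: leey.
  move=> _; rewrite -EFinD lee_fin dotBl.
  suff :  dot u (z - y) + a - b <= dot (grad h y) (z - y) by lra.
  apply: (le_directional_derivative hd) => t /andP[t0 t1].
  have t01 : 0 <= t <= 1 by rewrite ltW.
  have := le_trans (sub _) (leeD2l _ (psiconv z y t t01)).
  rewrite -segE addrK dotZr /psi_h py pz -!EFinM -!EFinD lee_fin; lra.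
- have := sub z; rewrite /psi_h.
  move: yfin; case py: (psi y) => [a| |]// _.
  case: (psi z) => [b| |]//; last by move=> _; exact: leey.
  rewrite -!EFinD !lee_fin dotBl.
  suff : h y - h z <= dot (- grad h y) (z - y).
    by rewrite -[- grad h y]scaleN1r dotZl; lra.
  have hdN : is_diff y (- h) (dot (- grad h y)).
    apply: (is_diff_eq (is_diffN hd)); apply/funext => w.
    by rewrite -[- grad h y in RHS]scaleN1r dotZl mulN1r.
  apply: (le_directional_derivative hdN) => t /andP[t0 t1].
  have hzy : h (t *: z + (1 - t) *: y) <= t * h z + (1 - t) * h y.
    exact: (hconv (Itv01 (ltW t0) t1) z y (mem_setT _) (mem_setT _)).
  by move: hzy; rewrite -segE !fctE; lra.
Qed.
End Conjugate.

(** * The gradient of theta *)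

Section GradientRules.
Variable R : realType.

Lemma is_diff_gradD n (f1 f2 : 'cV[R]_n -> R) x p1 p2 :
  is_diff x f1 (dot p1) -> is_diff x f2 (dot p2) ->
  is_diff x (f1 + f2) (dot (p1 + p2)).
Proof.
move=> d1 d2; apply: (is_diff_eq (is_diffD d1 d2)).
by apply/funext => v; rewrite dotDl.
Qed.

Lemma is_diff_grad_mulmx n k (M : 'M[R]_(k, n)) (f : 'cV[R]_k -> R) x p :
  is_diff (M *m x) f (dot p) -> is_diff x (f \o mulmx M) (dot (M^T *m p)).
Proof.
move=> fd; apply: (is_diff_eq (is_diff_comp (is_diff_mulmx M x) fd)).
by apply/funext => v; rewrite /= dot_mulmx.
Qed.

End GradientRules.

Lemma ereal_sup_addr (R : realType) (T : Type) (F : T -> \bar R) (k : R) :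
  ereal_sup (range (fun y => F y + k%:E)%E) = (ereal_sup (range F) + k%:E)%E.
Proof.
apply/eqP; rewrite eq_le; apply/andP; split.
  apply: ge_ereal_sup => _ [y _ <-]; rewrite leeD2r//.
  by apply: ereal_sup_ubound; exists y.
rewrite -leeBrDr//; apply: ge_ereal_sup => _ [y _ <-].
by rewrite leeBrDr//; apply: ereal_sup_ubound; exists y.
Qed.

Section Theta.
Variables (R : realType) (n m q : nat).
Variables (K : 'M[R]_(n, m)) (A : 'M[R]_(q, n)) (B : 'M[R]_(q, m)).
Variable c : 'cV[R]_q.
Variables (g : 'cV[R]_n -> R) (h : 'cV[R]_m -> R) (psi : 'cV[R]_m -> \bar R).
Context (mu : R) (mu_gt0 : 0 < mu) (h_diff : forall y, differentiable h y)
  (psi_proper : proper psi) (psi_lsc : lower_semicontinuous psi)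
  (psi_h_sc : strongly_convex mu (psi_h h psi)).

Let h_cont : continuous h.
Proof. by move=> y; exact: differentiable_continuous. Qed.

(** A subgradient [u] at [z] forces [z] to be the gradient of the conjugate at
    [u].  The converse holds because [u] is a subgradient at some point, which
    by the first part is that gradient. *)
Lemma subdiff_grad_conjugate y u :
  subdiff (psi_h h psi) y u <-> y = grad_psi_h_conj h psi u.
Proof.
have grad_of z : subdiff (psi_h h psi) z u -> grad_psi_h_conj h psi u = z.
  by move=> zu; exact: is_diff_grad (is_diff_conjugate mu_gt0 psi_h_sc zu).
split=> [/grad_of//|->].
have [z zu] := subdiff_surjective u mu_gt0 h_cont psi_proper psi_lsc psi_h_sc.
by rewrite (grad_of _ zu).
Qed.

Lemma conjugate_fin u : conjugate (psi_h h psi) u \is a fin_num.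
Proof.
have [y yu] := subdiff_surjective u mu_gt0 h_cont psi_proper psi_lsc psi_h_sc.
have [/fineK/esym fy _] := yu.
by have [d] := conjugate_expansion 0 mu_gt0 psi_h_sc fy yu; rewrite add0r => ->.
Qed.

Lemma thetaE (z : 'cV[R]_(n + q)) : theta K A B c g h psi z =
  g (usubmx z)
  + fine (conjugate (psi_h h psi) (K^T *m usubmx z + B^T *m dsubmx z))
  + dot (dsubmx z) (A *m usubmx z + c).
Proof.
set x := usubmx z; set l := dsubmx z; set u := _ + B^T *m l.
have QE : (fun y => Q K A B c h psi x y l) =
    (fun y => (dot u y)%:E - psi_h h psi y + (dot l (A *m x + c))%:E)%E.
  apply/funext => y; rewrite /Q /psi_h /u !dotDr !dotDl !dot_mulmx.
  have [->|[b ->]] := proper_cases y psi_proper; first by [].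
  by rewrite -!(EFinB, EFinD); congr EFin; ring.
by rewrite /theta QE ereal_sup_addr fineD ?conjugate_fin// addrA.
Qed.

(** [theta] is written as a sum of [g] and the conjugate, each composed with a
    linear map of the stacked vector, a quadratic form for [dot l (A *m x)] and
    a linear form for [dot l c]. *)
Lemma is_diff_theta x l y : differentiable g x ->
  y = grad_psi_h_conj h psi (K^T *m x + B^T *m l) ->
  is_diff (col_mx x l) (theta K A B c g h psi)
    (dot (col_mx (K *m y + A^T *m l + grad g x) (A *m x + B *m y + c))).
Proof.
move=> gx /subdiff_grad_conjugate yu.
pose P : 'M[R]_(n, n + q) := row_mx 1%:M 0.
pose M : 'M[R]_(m, n + q) := row_mx K^T B^T.
pose N : 'M[R]_(n + q) := block_mx 0 0 A 0.
have PE z : P *m z = usubmx z.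
  by rewrite -[z in LHS]vsubmxK mul_row_col mul1mx mul0mx addr0.
have ME z : M *m z = K^T *m usubmx z + B^T *m dsubmx z.
  by rewrite -[z in LHS]vsubmxK mul_row_col.
have NE z : N *m z = col_mx 0 (A *m usubmx z).
  by rewrite -[z in LHS]vsubmxK mul_block_col !mul0mx !addr0.
pose fs w := fine (conjugate (psi_h h psi) w).
have thetaD : theta K A B c g h psi = (g \o mulmx P) + (fs \o mulmx M) +
    (fun z => dot z (N *m z)) + dot (col_mx 0 c).
  have dot_low z (w : 'cV[R]_q) : dot z (col_mx 0 w) = dot (dsubmx z) w.
    by rewrite -[z in LHS]vsubmxK dot_col_mx [dot _ 0]linear0 add0r.
  apply/funext => z; rewrite thetaE !fctE /= PE NE [dot _ z]dotC !dot_low.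
  by rewrite dotDr addrA /fs ME.
rewrite thetaD; set p := dot _.
have gd : is_diff (P *m col_mx x l) g (dot (grad g x)).
  by rewrite PE col_mxKu; exact: differentiable_is_diff.
have fd : is_diff (M *m col_mx x l) fs (dot y).
  by rewrite mul_row_col; exact: is_diff_conjugate psi_h_sc yu.
apply: (is_diff_eq (is_diff_gradD (is_diff_gradD (is_diff_gradD
  (is_diff_grad_mulmx gd) (is_diff_grad_mulmx fd))
  (is_diff_quadratic_form N _)) (is_diff_dot (col_mx 0 c) _))).
rewrite /p; congr dot; rewrite NE col_mxKu.
rewrite tr_row_mx trmx1 trmx0 mul_col_mx mul1mx mul0mx.
rewrite tr_row_mx !trmxK mul_col_mx tr_block_mx !trmx0 mul_block_col.
rewrite !mul0mx !add_col_mx !add0r !addr0.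
by congr col_mx; [rewrite -addrA addrC | rewrite [_ + A *m x]addrC].
Qed.

End Theta.

(** * Critical points of theta and stationary points *)

Theorem proposition3p2 (R : realType) (n m q : nat)
    (K : 'M[R]_(n, m)) (A : 'M[R]_(q, n)) (B : 'M[R]_(q, m)) (c : 'cV[R]_q)
    (g : 'cV[R]_n -> R) (h : 'cV[R]_m -> R)
    (phi : 'cV[R]_n -> \bar R) (psi : 'cV[R]_m -> \bar R)
    (Lg Lh mu : R)
    (g_convex : convex_function [set: 'cV[R]_n] g)
    (h_convex : convex_function [set: 'cV[R]_m] h)
    (g_C1 : C1 g) (h_C1 : C1 h)
    (Lg_gt0 : 0 < Lg) (Lh_gt0 : 0 < Lh)
    (g_lip : lipschitz_grad Lg g) (h_lip : lipschitz_grad Lh h)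
    (phi_proper : proper phi) (phi_lsc : lower_semicontinuous phi)
    (phi_convex : econvex phi)
    (psi_proper : proper psi) (psi_lsc : lower_semicontinuous psi)
    (psi_convex : econvex psi)
    (mu_gt0 : 0 < mu) (psi_h_sc : strongly_convex mu (psi_h h psi))
    (xbar : 'cV[R]_n) (lambar : 'cV[R]_q) :
  let ybar := grad_psi_h_conj h psi (K^T *m xbar + B^T *m lambar) in
  (critical K A B c g h phi psi xbar lambar <->
   stationary_with K A B c g h phi psi xbar ybar lambar) /\
  (stationary K A B c g h phi psi xbar ybar <->
   exists lam' : 'cV[R]_q,
     ybar = grad_psi_h_conj h psi (K^T *m xbar + B^T *m lam') /\
     critical K A B c g h phi psi xbar lam').
Proof.
move=> ybar; have [g_diff _] := g_C1; have [h_diff _] := h_C1.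
(* The second stationarity inclusion alone determines [y]. *)
have optP y l : [set K^T *m xbar + B^T *m l - grad h y - v | v in subdiff psi y] 0
    <-> y = grad_psi_h_conj h psi (K^T *m xbar + B^T *m l).
  rewrite -(subdiff_grad_conjugate mu_gt0 h_diff psi_proper psi_lsc psi_h_sc).
  rewrite (subdiff_psi_h _ h_convex (h_diff y) psi_convex); split.
    by move=> [v vpsi /eqP]; rewrite subr_eq0 => /eqP ->.
  by move=> vpsi; exists (K^T *m xbar + B^T *m l - grad h y) => //; rewrite subrr.
have critP y l : y = grad_psi_h_conj h psi (K^T *m xbar + B^T *m l) ->
    critical K A B c g h phi psi xbar l <->
    stationary_with K A B c g h phi psi xbar y l.
  move=> yE; have dtheta := is_diff_theta A c mu_gt0 h_diff psi_proper
    psi_lsc psi_h_sc (g_diff xbar) yE.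
  rewrite /critical (is_diff_grad dtheta); split.
    move=> [v vphi]; rewrite add_col_mx addr0 -col_mx0 => /eq_col_mx[vE cE].
    by split => //; [exists v | exact/optP].
  move=> [[v vphi vE] _ cE]; exists v => //.
  by rewrite add_col_mx addr0 vE cE col_mx0.
split; first exact: (critP ybar lambar erefl).
split=> [[l st]|[l [yE crit]]]; last first.
  by exists l; have [+ _] := critP ybar l yE; apply.
have yE : ybar = grad_psi_h_conj h psi (K^T *m xbar + B^T *m l).
  by have [_ stpsi _] := st; have [+ _] := optP ybar l; apply.
exists l; split; first exact: yE.
have [_ st_crit] := critP ybar l yE; exact: st_crit.
Qed.
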